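(* Let $\{p_{\varepsilon,\lambda}\}$ be a family of probability densities with respect to a measure $\varpi$ such that $\Phi(\varepsilon,\lambda)=2\sqrt{p_{\varepsilon,\lambda}}$ is twice continuously Fréchet differentiable at $(0,0)$ as an $L^2(\varpi)$-valued map (one-sided in $\varepsilon$ if only $\varepsilon\ge 0$ is available) and $\Phi(0,\lambda)=\Phi(0,-\lambda)$ for small $|\lambda|$. Assume $p_0=p_{0,0}>0$ on the relevant support, and let $J_-^\perp,J_+^\perp$ be the efficient odd and even jets and $\Phi^{\mathrm{eff}}$ the effective Hellinger map defined in the context. Suppose $$\Delta_{\mathrm{eff}}:=\|J_-^\perp\|^2\|J_+^\perp\|^2-\langle J_-^\perp,J_+^\perp\rangle^2>0 .$$ Then, after an invertible linear change of coordinates in the two-dimensional target plane $\operatorname{span}\{J_-^\perp,J_+^\perp\}$, the essential second jet of $\Phi^{\mathrm{eff}}$ at $(0,0)$ is $$(\varepsilon,\lambda)\longmapsto\left(\varepsilon,\ \varepsilon\lambda,\ \frac{\lambda^2}{2}\right).$$ For a signed unfolding parameter $\varepsilon$ this is the standard cross-cap $2$-jet up to smooth linear rescalings; if only $\varepsilon\ge0$ is available, the family realizes its one-sided source restriction.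
   Context: Let $P_0$ be the law with density $p_0$ and $\mathcal H=L^2_0(P_0)$ the space of centered square-integrable functions. The jets $\partial^2_{\varepsilon\lambda}\Phi(0,0)$ and $\partial^2_{\lambda\lambda}\Phi(0,0)$ are orthogonal to $\sqrt{p_0}$ and are written $\partial^2_{\varepsilon\lambda}\Phi(0,0)=\sqrt{p_0}\,J_-$, $\partial^2_{\lambda\lambda}\Phi(0,0)=\sqrt{p_0}\,J_+$ with $J_\pm\in\mathcal H$. A regular finite-dimensional nuisance parameter may be present; $\mathcal N\subset\mathcal H$ is the closed span of its score directions at the symmetric point, $\Pi_{\mathcal N}$ the orthogonal projection onto $\mathcal N$, and $J_\pm^\perp=(I-\Pi_{\mathcal N})J_\pm$. Norms and inner products are those of $L^2(P_0)$. Let $\mathcal I_H:\mathcal H\to L^2(\varpi)$, $\mathcal I_Hf=\sqrt{p_0}f$ (an isometry), and $\mathcal E_H=\mathcal I_H(\mathcal H)/\mathcal I_H(\mathcal N)$, identified with $\mathcal H/\mathcal N$ via $\mathcal I_H$ and hence with the orthogonal complement of $\mathcal N$ in $\mathcal H$. The effective Hellinger map is $$\Phi^{\mathrm{eff}}(\varepsilon,\lambda)=\bigl(\varepsilon,\ [\,2\sqrt{p_{\varepsilon,\lambda}}-2\sqrt{p_{\varepsilon,0}}\,]\bigr),$$ where $[\cdot]$ is the class modulo $\mathcal I_H(\mathcal N)$ (taken in $L^2(\varpi)/\mathcal I_H(\mathcal N)\supset\mathcal E_H$; its Taylor coefficients of order at most two at the origin lie in $\mathcal E_H$). Its second jet is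 its Taylor polynomial of degree $2$ at $(0,0)$. The statement concerns only this $2$-jet, not full $\mathcal A$-equivalence of maps. *)

(* Defs.v *)
From HB Require Import structures.
From mathcomp Require Import all_boot all_order all_algebra.
From mathcomp Require Import ring_quotient generic_quotient.
From mathcomp Require Import all_classical all_reals all_analysis.

Set Implicit Arguments.
Unset Strict Implicit.
Unset Printing Implicit Defensive.

Import Order.TTheory GRing.Theory Num.Theory.
Import numFieldNormedType.Exports.

Local Open Scope classical_set_scope.
Local Open Scope ring_scope.
Local Open Scope quotient_scope.

(* Quotient of a module by a submodule; ring_quotient only provides the
   additive structure. *)
Section quotmod.
Context {R : nzRingType} {V : lmodType R} (S : zmodClosed V) (SZ : scaler_closed S).

Definition quotmod of scaler_closed S : Type := Quotient.quot S.
Local Notation Q := (quotmod SZ).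
HB.instance Definition _ := EqQuotient.on Q.
HB.instance Definition _ := GRing.Zmodule.on Q.

Definition quotmod_pi (v : V) : Q := \pi_Q v.

Definition quotmod_scale (a : R) (x : Q) : Q :=
  quotmod_pi (a *: repr x).

Lemma quotmod_piP (u v : V) : reflect (quotmod_pi u = quotmod_pi v) (u - v \in S).
Proof. by rewrite Quotient.idealrBE; exact: eqP. Qed.

Lemma quotmod_reprK (x : Q) : quotmod_pi (repr x) = x.
Proof. exact: reprK. Qed.

Lemma quotmod_piD (u v : V) : quotmod_pi (u + v) = quotmod_pi u + quotmod_pi v.
Proof. by rewrite /quotmod_pi [RHS]piE. Qed.

Lemma quotmod_piZ (a : R) (v : V) : quotmod_scale a (quotmod_pi v) = quotmod_pi (a *: v).
Proof.
by apply/quotmod_piP; rewrite -scalerBr; apply/SZ/quotmod_piP/quotmod_reprK.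
Qed.

Lemma quotmod_scaleA a b x :
  quotmod_scale a (quotmod_scale b x) = quotmod_scale (a * b) x.
Proof. by rewrite -[x]quotmod_reprK !quotmod_piZ scalerA. Qed.

Lemma quotmod_scale1 : left_id 1 quotmod_scale.
Proof. by move=> x; rewrite /quotmod_scale scale1r quotmod_reprK. Qed.

Lemma quotmod_scaleDr : right_distributive quotmod_scale +%R.
Proof.
move=> a x y; rewrite -[x in LHS]quotmod_reprK -[y in LHS]quotmod_reprK.
by rewrite -quotmod_piD quotmod_piZ scalerDr quotmod_piD.
Qed.

Lemma quotmod_scaleDl x : {morph quotmod_scale^~ x : a b / a + b}.
Proof. by move=> a b; rewrite /quotmod_scale scalerDl quotmod_piD. Qed.

HB.instance Definition _ := GRing.Zmodule_isLmodule.Build R Q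
  quotmod_scaleA quotmod_scale1 quotmod_scaleDr quotmod_scaleDl.

End quotmod.

Section quotnorm.
Context {R : realType} {V : lmodType R} {S : zmodClosed V} {SZ : scaler_closed S}.

Definition quotnorm (nu : V -> R) (x : quotmod SZ) : R :=
  inf [set nu v | v in [set v | quotmod_pi SZ v = x]].

End quotnorm.

(* Differential calculus for maps from a normed space into a vector space whose
   norm [nu] is given explicitly. All limits are taken within the source [D], so
   that a half-plane [D] gives one-sided differentiability at its edge. *)
Section frechet.
Context {R : realType} {U : normedModType R} {V : lmodType R}.
Variables (nu : V -> R) (D : set U).

Definition bounded_linear (L : U -> V) : Prop :=
  linear L /\ exists M : R, forall h, nu (L h) <= M * `|h|.

Definition bounded_bilinear (B : U -> U -> V) : Prop :=
  [/\ forall k, linear (B^~ k), forall h, linear (B h) &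
      exists M : R, forall h k, nu (B h k) <= M * `|h| * `|k|].

Definition frechet_diff_at (F : U -> V) (x : U) (L : U -> V) : Prop :=
  bounded_linear L /\
  forall e : R, 0 < e -> \forall y \near within D (nbhs x),
    nu (F y - F x - L (y - x)) <= e * `|y - x|.

(* [B h k] is the derivative of [x |-> dF x k] along [h]; the remainder is
   controlled in operator norm, i.e. uniformly in [k]. *)
Definition frechet_diff2_at (dF : U -> U -> V) (x : U) (B : U -> U -> V) : Prop :=
  bounded_bilinear B /\
  forall e : R, 0 < e -> \forall y \near within D (nbhs x), forall k,
    nu (dF y k - dF x k - B (y - x) k) <= e * `|y - x| * `|k|.

Definition C2_at (F : U -> V) (x0 : U)
    (dF : U -> U -> V) (d2F : U -> U -> U -> V) : Prop :=
  [/\ \forall x \near within D (nbhs x0), frechet_diff_at F x (dF x),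
      \forall x \near within D (nbhs x0), frechet_diff2_at dF x (d2F x) &
      forall e : R, 0 < e -> \forall x \near within D (nbhs x0), forall h k,
        nu (d2F x h k - d2F x0 h k) <= e * `|h| * `|k|].

Definition is_jet2 (F : U -> V) (x0 : U) (j : U -> V) : Prop :=
  exists dF d2F, C2_at F x0 dF d2F /\
    forall h, j h = F x0 + dF x0 h + 2^-1 *: d2F x0 h h.

End frechet.

Notation L2fun mu := (LfunType mu (lee1n 2)).

Section L2.
Context {d : measure_display} {T : measurableType d} {R : realType}.
Implicit Types (mu : {measure set T -> \bar R}).

Definition l2norm {mu} (f : L2fun mu) : R := fine ('N[mu]_2%:E[EFin \o f])%E.

Definition l2dot {mu} (f g : L2fun mu) : R := \int[mu]_t (f t * g t).

Definition ae_zero mu : {pred L2fun mu} :=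
  fun f => `[< {ae mu, forall t, f t = 0} >].

Lemma ae_zero_submod mu : GRing.subsemimod_closed (@ae_zero mu).
Proof.
split; first split.
- by apply/asboolP/nearW.
- move=> f g /asboolP f0 /asboolP g0; apply/asboolP.
  by apply: filterS2 f0 g0 => t ft gt; rewrite -[LHS]/(f t + g t) ft gt addr0.
- move=> a f /asboolP f0; apply/asboolP.
  by apply: filterS f0 => t ft; rewrite -[LHS]/(a * f t) ft mulr0.
Qed.

HB.instance Definition _ mu :=
  GRing.isSubmodClosed.Build R (L2fun mu) (@ae_zero mu) (@ae_zero_submod mu).

Definition L2 mu := quotmod (GRing.subsemimod_closedZ (@ae_zero_submod mu)).

Definition L2class {mu} (f : L2fun mu) : L2 mu := quotmod_pi _ f.

Definition L2norm {mu} : L2 mu -> R := quotnorm l2norm.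

Definition closed_span {mu} k (s : 'I_k -> L2fun mu) : set (L2fun mu) :=
  [set f | forall e : R, 0 < e ->
     exists c : 'I_k -> R, l2norm (f - \sum_(i < k) c i *: s i) < e].

Lemma l2norm0 mu : l2norm (0 : L2fun mu) = 0.
Proof.
rewrite /l2norm (_ : EFin \o _ = cst 0%E)// Lnorm0//.
Qed.

Lemma l2normD mu (f g : L2fun mu) : l2norm (f + g) <= l2norm f + l2norm g.
Proof. exact: ler_LnormD. Qed.

Lemma l2normZ mu a (f : L2fun mu) : l2norm (a *: f) = `|a| * l2norm f.
Proof.
apply: EFin_inj; rewrite EFinM !finite_norm_fine -LnormZ; exact: eq_Lnorm.
Qed.

Lemma closed_span_submod mu k (s : 'I_k -> L2fun mu) :
  [/\ closed_span s 0,
      forall f g, closed_span s f -> closed_span s g -> closed_span s (f + g) &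
      forall a f, closed_span s f -> closed_span s (a *: f)].
Proof.
split=> [e e0|f g sf sg e e0|a f sf e e0].
- exists (fun=> 0); rewrite big1 ?subr0 ?l2norm0// => i _.
  by rewrite scale0r.
- have e20 : 0 < e / 2 by rewrite divr_gt0.
  have [c fc] := sf _ e20; have [b gb] := sg _ e20.
  exists (fun i => c i + b i).
  under eq_bigr do rewrite scalerDl.
  rewrite big_split/= opprD addrACA (le_lt_trans (l2normD _ _))//.
  by rewrite [e]splitr ltrD.
- have a0 : 0 < `|a| + 1 by rewrite ltr_wpDl.
  have [c fc] := sf _ (divr_gt0 e0 a0).
  exists (fun i => a * c i).
  under eq_bigr do rewrite -scalerA.
  rewrite -scaler_sumr -scalerBr l2normZ.
  have [->|an0] := eqVneq a 0; first by rewrite normr0 mul0r.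
  rewrite (@lt_trans _ _ (`|a| * (e / (`|a| + 1))))// ?ltr_pM2l ?normr_gt0//.
  by rewrite mulrCA gtr_pMr// ltr_pdivrMr// mul1r ltrDl.
Qed.

(* Determined up to a.e. equality; the default is not reached when [N] is the
   closed span of finitely many functions. *)
Definition orth_proj {mu} (N : set (L2fun mu)) (f : L2fun mu) : L2fun mu :=
  xget 0 [set g | N g /\ forall n, N n -> l2dot (f - g) n = 0].

End L2.

(* [nu] plays the role of the law with density [p0]. *)
Section hellinger.
Context {d : measure_display} {T : measurableType d} {R : realType}.
Context {mu nu : {measure set T -> \bar R}}.
Implicit Types (p : R * R -> T -> R) (f : T -> R).

Definition is_density (f : T -> R) : Prop :=
  [/\ measurable_fun setT f, forall t, 0 <= f t &
      (\int[mu]_t (f t)%:E)%E = 1%E].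

(* [insubd] only supplies a totality default: [2 \sqrt f] is square-integrable
   whenever [f] is a density, and so is [\sqrt p0 f] whenever [f] is
   square-integrable for the law with density [p0]. *)
Definition root_density f : L2fun mu :=
  insubd (0 : L2fun mu) (fun t => 2 * Num.sqrt (f t)).

Definition hellinger_emb (p0 : T -> R) (f : L2fun nu) : L2fun mu :=
  insubd (0 : L2fun mu) (fun t => Num.sqrt (p0 t) * f t).

Definition centered (f : L2fun nu) : Prop := \int[nu]_t f t = 0.

(* [q] is a nuisance submodel through [p0], differentiable in quadratic mean at
   [0], and [s i] is its score in the [i]-th coordinate direction. *)
Definition nuisance_scores (p0 : T -> R) k (q : 'rV[R]_k -> T -> R)
    (s : 'I_k -> L2fun nu) : Prop :=
  [/\ q 0 = p0, \forall eta \near (0 : 'rV[R]_k), is_density (q eta),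
      forall i, centered (s i) &
      exists2 L : 'rV[R]_k -> L2 mu,
        frechet_diff_at L2norm setT (fun eta => L2class (root_density (q eta))) 0 L
        & forall i, L (delta_mx 0 i) = L2class (hellinger_emb p0 (s i))].

Section effective.
Variables (p0 : T -> R) (k : nat) (s : 'I_k -> L2fun nu).

Definition nuisance_image : {pred L2fun mu} :=
  fun g => `[< exists2 n : L2fun nu, closed_span s n &
               {ae mu, forall t, g t = Num.sqrt (p0 t) * n t} >].

Lemma nuisance_image_submod : GRing.subsemimod_closed nuisance_image.
Proof.
have [s0 sD sZ] := closed_span_submod s.
split; first split.
- by apply/asboolP; exists 0 => //; apply/nearW => t; rewrite [RHS]mulr0.
- move=> f g /asboolP[m sm fm] /asboolP[n sn gn]; apply/asboolP.
  exists (m + n); first exact: sD.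
  apply: filterS2 fm gn => t ft gt.
  by rewrite -[LHS]/(f t + g t) ft gt -mulrDr.
- move=> a f /asboolP[m sm fm]; apply/asboolP.
  exists (a *: m); first exact: sZ.
  apply: filterS fm => t ft.
  by rewrite -[LHS]/(a * f t) ft mulrCA.
Qed.

HB.instance Definition _ := GRing.isSubmodClosed.Build R (L2fun mu)
  nuisance_image nuisance_image_submod.

(* L^2(mu) / I_H(N). Functions that vanish a.e. belong to [nuisance_image], so
   this is already a quotient of the space of classes. *)
Definition eff_space := quotmod (GRing.subsemimod_closedZ nuisance_image_submod).

Definition eff_class (f : L2fun mu) : eff_space := quotmod_pi _ f.

Definition eff_norm (y : R * eff_space) : R :=
  Num.max `|y.1|
    (quotnorm (SZ := GRing.subsemimod_closedZ nuisance_image_submod) l2norm y.2).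

Definition eff_hellinger p (x : R * R) : R * eff_space :=
  (x.1, eff_class (root_density (p x) - root_density (p (x.1, 0)))).

Definition eff_plane (f g : L2fun nu) : set eff_space :=
  [set u | exists a b : R, u = a *: eff_class (hellinger_emb p0 f) +
                               b *: eff_class (hellinger_emb p0 g)].

End effective.
End hellinger.

Arguments is_density {d T R} mu f.
Arguments root_density {d T R} mu f.
Arguments nuisance_scores {d T R} mu {nu} p0 {k} q s.
Arguments eff_space {d T R} mu {nu} p0 {k} s.
Arguments eff_class {d T R mu nu} p0 {k} s f.
Arguments eff_norm {d T R mu nu} p0 {k} s y.
Arguments eff_hellinger {d T R mu nu} p0 {k} s p x.
Arguments eff_plane {d T R mu nu} p0 {k} s f g.

Section crosscap.
Context {R : realType}.

Definition source (signed : bool) : set (R * R) :=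
  if signed then setT else [set x | 0 <= x.1].

Definition crosscap (x : R * R) : R * (R * R) := (x.1, (x.1 * x.2, x.2 ^+ 2)).

Definition rescale2 (a b : R) (x : R * R) : R * R := (a * x.1, b * x.2).

Definition rescale3 (a b c : R) (y : R * (R * R)) : R * (R * R) :=
  (a * y.1, (b * y.2.1, c * y.2.2)).

End crosscap.

(* Main.v *)
Require Import Defs.
From mathcomp Require Import all_boot all_order all_algebra.
From mathcomp Require Import all_classical all_reals all_analysis.
From mathcomp Require Import measurable_realfun ring lra.

Set Implicit Arguments.
Unset Strict Implicit.
Unset Printing Implicit Defensive.

Import Order.TTheory GRing.Theory Num.Theory.
Import numFieldNormedType.Exports.

Local Open Scope classical_set_scope.
Local Open Scope ring_scope.

(** Write [B] for the second derivative of the root density map [Phi] at the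
origin, and [e1], [e2] for the two coordinate directions of the source. The
effective map is the class modulo the nuisance space of
[Phi (e, l) - Phi (e, 0)], that is, of [Phi] minus its composition with the
projection onto the first axis. Passing to classes is linear and does not
increase norms, so the effective map is again C2 within the source
([C2_at_pre], [C2_at_sub], [C2_at_post], [C2_at_pair]) and its 2-jet is the
class of
[[
  dPhi (l e2) + (B (h, h) - B (e e1, e e1)) / 2,     h = e e1 + l e2.
]]
The first order term vanishes because [Phi] is even along the second axis at
[e = 0] ([frechet_diff_even]). By bilinearity the second order term equals
[e l B (e1, e2) + l ^ 2 / 2 B (e2, e2)], provided that [B] is symmetric. The
two values of [B] are the images of the odd and the even jet, and subtracting
from a jet its nuisance projection does not change the class
([eff_class_perp]). Hence the jet is
[(e, e l u + l ^ 2 / 2 v)] with [u], [v] the classes of the efficient jets, and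
the linear change of coordinates [A] is the one that sends [u] and [v] to the
standard basis of the plane.

Three points need an argument.

- Symmetry of [B]. Derivatives are taken within the source, which may be a
  half-plane with the origin on its edge. For a real-valued map, the second
  difference over the square with corner at the origin and side [t] lies in
  the source, and two applications of the mean value theorem, one for each
  order of the variables, show that it is both [t ^ 2 B (e1, e2) + o(t ^ 2)]
  and [t ^ 2 B (e2, e1) + o(t ^ 2)] ([schwarz_scalar]). The pairings with
  square-integrable functions separate the points of L^2 and reduce the case of
  [Phi] to real-valued maps ([schwarz_L2]).

- [u] and [v] are linearly independent ([eff_class_perp_free]). If
  [a u + b v = 0], then [w = a J_-^perp + b J_+^perp] lies in the nuisance space
  up to a null function. Both efficient jets are orthogonal to that space, so
  [w] is orthogonal to both of them, and their Gram determinant, the effective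
  discriminant, is positive; thus [a = b = 0]. This uses that orthogonal
  projections onto the closed span of finitely many functions exist
  ([orth_projP]), which is shown by the Gram-Schmidt recursion.

- Multiplication by the root of the density carries L^2 of the law into L^2 of
  the dominating measure ([hellinger_embE]) and is injective on classes
  ([hellinger_inj]). The first fact is the change of variables formula for a
  measure given by a density ([integral_density]), the second holds because the
  law does not charge the zero set of its density. *)

(** * Differential calculus within a source *)

Lemma near_within_normP {R : realType} {U : normedModType R} (D P : set U) (x : U) :
  (\forall y \near within D (nbhs x), P y) <->
  exists2 r : R, 0 < r & forall y, `|y - x| < r -> D y -> P y.
Proof.
rewrite near_withinE; split.
  move=> /nbhs_normP[r /= r0 xP]; exists r => // y yr; apply: xP => /=.
  by rewrite -normrN opprB.
move=> [r r0 xP]; apply/nbhs_normP; exists r => //= y /= yr.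
by apply: xP; rewrite -normrN opprB.
Qed.

(** The predicates of differential calculus assert [linear A] of a plain function,
which carries no bundled structure; these are the usual rules in that form. *)
Section bare_linear.
Context {R : realType} {V W : lmodType R} (A : V -> W).
Hypothesis linA : linear A.

Lemma bare_linear0 : A 0 = 0.
Proof. by have /= := linA (-1) 0 0; rewrite scaler0 addr0 scaleN1r addNr. Qed.

Lemma bare_linearB u v : A (u - v) = A u - A v.
Proof. by rewrite addrC -scaleN1r linA scaleN1r addrC. Qed.

Lemma bare_linearD u v : A (u + v) = A u + A v.
Proof. by have /= := linA 1 u v; rewrite !scale1r. Qed.

Lemma bare_linearZ a u : A (a *: u) = a *: A u.
Proof. by have /= := linA a u 0; rewrite !addr0 bare_linear0 addr0. Qed.
End bare_linear.

Section postcomposition.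
Context {R : realType} {U : normedModType R} {V W : lmodType R}.
Variables (nuV : V -> R) (nuW : W -> R) (A : V -> W) (C : R) (D : set U).
Hypothesis linA : linear A.
Hypothesis C0 : 0 < C.
Hypothesis bndA : forall v, nuW (A v) <= C * nuV v.

Lemma frechet_diff_at_post F x L :
  frechet_diff_at nuV D F x L -> frechet_diff_at nuW D (A \o F) x (A \o L).
Proof.
move=> [[linL [M LM]] FL]; split.
  split; first by move=> a u v /=; rewrite linL linA.
  exists (C * M) => h; rewrite (le_trans (bndA _))// -mulrA.
  by rewrite ler_pM2l.
move=> e e0; have := FL _ (divr_gt0 e0 C0); apply: filterS => y yL /=.
rewrite -!(bare_linearB linA) (le_trans (bndA _))//.
by rewrite -ler_pdivlMl// mulrA [C^-1 * _]mulrC.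
Qed.

Lemma frechet_diff2_at_post dF x B :
  frechet_diff2_at nuV D dF x B ->
  frechet_diff2_at nuW D (fun y => A \o dF y) x (fun h => A \o B h).
Proof.
move=> [[Bl Br [M BM]] FB]; split.
  split.
  - by move=> k a u v /=; rewrite (Bl k) linA.
  - by move=> h a u v /=; rewrite (Br h) linA.
  - exists (C * M) => h k; rewrite (le_trans (bndA _))// -!mulrA.
    by rewrite ler_pM2l// mulrA.
move=> e e0; have := FB _ (divr_gt0 e0 C0); apply: filterS => y yB k /=.
rewrite -!(bare_linearB linA) (le_trans (bndA _))//.
by rewrite -ler_pdivlMl// !mulrA [C^-1 * _]mulrC.
Qed.

(** A linear map of bounded seminorm commutes with all limits in the definition,
and its bound [C] is absorbed by running them with [e / C]. This is used both
for the passage to classes modulo the nuisance space and for real-valued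
pairings. *)
Lemma C2_at_post F x dF d2F : C2_at nuV D F x dF d2F ->
  C2_at nuW D (A \o F) x (fun y => A \o dF y) (fun y h => A \o d2F y h).
Proof.
move=> [d1 d2 cont]; split.
- by apply: filterS d1 => y; exact: frechet_diff_at_post.
- by apply: filterS d2 => y; exact: frechet_diff2_at_post.
move=> e e0; have := cont _ (divr_gt0 e0 C0); apply: filterS => y yB h k /=.
rewrite -!(bare_linearB linA) (le_trans (bndA _))//.
by rewrite -ler_pdivlMl// !mulrA [C^-1 * _]mulrC.
Qed.
End postcomposition.

(** Precomposition with an affine map [P] of linear part [P0] that does not increase
norms. Affine maps between different spaces are allowed so that the same result
serves for the projection onto the first axis and for restriction to segments. *)
Section precomposition.
Context {R : realType} {U U' : normedModType R} {V : lmodType R}.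
Variables (nu : V -> R) (D : set U) (D' : set U') (P P0 : U' -> U).
Hypothesis linP0 : linear P0.
Hypothesis affP : forall x y, P y - P x = P0 (y - x).
Hypothesis shortP0 : forall u, `|P0 u| <= `|u|.
Hypothesis PD : forall u, D' u -> D (P u).

Let near_pre x (Q : set U) : (\forall y \near within D (nbhs (P x)), Q y) ->
  \forall y \near within D' (nbhs x), Q (P y).
Proof.
move=> /near_within_normP[r r0 rQ]; apply/near_within_normP; exists r => // y yr Dy.
by apply: rQ; [rewrite affP (le_lt_trans (shortP0 _))|exact: PD].
Qed.

Let bndP0 M (t : R) (u : U') : t <= M * `|P0 u| -> t <= `|M| * `|u|.
Proof.
move=> /le_trans; apply; rewrite (@le_trans _ _ (`|M| * `|P0 u|))//.
  by rewrite ler_wpM2r// ler_norm.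
by rewrite ler_wpM2l.
Qed.

Lemma frechet_diff_at_pre F x L :
  frechet_diff_at nu D F (P x) L -> frechet_diff_at nu D' (F \o P) x (L \o P0).
Proof.
move=> [[linL [M LM]] FL]; split.
  split; first by move=> a u v /=; rewrite linP0 linL.
  by exists `|M| => h; exact: bndP0 (LM _).
move=> e e0; have := near_pre (FL _ e0); apply: filterS => y /=.
by rewrite affP => /bndP0; rewrite (gtr0_norm e0).
Qed.

Lemma frechet_diff2_at_pre dF x B :
  frechet_diff2_at nu D dF (P x) B ->
  frechet_diff2_at nu D' (fun y => dF (P y) \o P0) x (fun h => B (P0 h) \o P0).
Proof.
move=> [[Bl Br [M BM]] FB]; split.
  split.
  - by move=> k a u v /=; rewrite linP0; exact: (Bl (P0 k)).
  - by move=> h a u v /=; rewrite linP0; exact: (Br (P0 h)).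
  - exists `|M| => h k /=.
    have /bndP0/le_trans := BM (P0 h) (P0 k); apply.
    by rewrite normrM normr_id ler_wpM2r// ler_wpM2l.
move=> e e0; have := near_pre (FB _ e0); apply: filterS => y + k /=.
move=> /(_ (P0 k)) /bndP0; rewrite affP => /le_trans; apply.
by rewrite normrM normr_id (gtr0_norm e0) ler_wpM2r// ler_wpM2l// ltW.
Qed.

Lemma C2_at_pre F x dF d2F : C2_at nu D F (P x) dF d2F ->
  C2_at nu D' (F \o P) x (fun y => dF (P y) \o P0)
    (fun y h => d2F (P y) (P0 h) \o P0).
Proof.
move=> [d1 d2 cont]; split.
- by apply: filterS (near_pre d1) => y; exact: frechet_diff_at_pre.
- by apply: filterS (near_pre d2) => y; exact: frechet_diff2_at_pre.
move=> e e0; have := near_pre (cont _ e0); apply: filterS => y + h k /=.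
move=> /(_ (P0 h) (P0 k)) /bndP0 => /le_trans; apply.
by rewrite normrM normr_id (gtr0_norm e0) ler_wpM2r// ler_wpM2l// ltW.
Qed.
End precomposition.

Lemma subr3ACA {V : zmodType} (a b c a' b' c' : V) :
  (a - a') - (b - b') - (c - c') = (a - b - c) - (a' - b' - c').
Proof. by rewrite !opprD !opprK [X in X + _ = _]addrACA [LHS]addrACA. Qed.

Section difference.
Context {R : realType} {U : normedModType R} {V : lmodType R}.
Variables (nu : V -> R) (D : set U).
Hypothesis nuB : forall u v, nu (u - v) <= nu u + nu v.

Lemma frechet_diff_at_sub F G x L K :
  frechet_diff_at nu D F x L -> frechet_diff_at nu D G x K ->
  frechet_diff_at nu D (F \- G) x (L \- K).
Proof.
move=> [[linL [M LM]] FL] [[linK [N KN]] GK]; split.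
  split=> [a u v /=|]; first by rewrite linL linK opprD addrACA scalerBr.
  exists (M + N) => h; rewrite mulrDl (le_trans (nuB _ _))//.
  exact: lerD.
move=> e e0; have e2 : 0 < e / 2 by rewrite divr_gt0.
apply: filterS2 (FL _ e2) (GK _ e2) => y yF yG /=.
by rewrite subr3ACA (le_trans (nuB _ _))// [e in leRHS]splitr mulrDl lerD.
Qed.

Lemma frechet_diff2_at_sub dF dG x B K :
  frechet_diff2_at nu D dF x B -> frechet_diff2_at nu D dG x K ->
  frechet_diff2_at nu D (fun y => dF y \- dG y) x (fun h => B h \- K h).
Proof.
move=> [[Bl Br [M BM]] FB] [[Kl Kr [N KN]] GK]; split.
  split=> [k a u v /=|h a u v /=|].
  - by rewrite (Bl k) (Kl k) opprD addrACA scalerBr.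
  - by rewrite (Br h) (Kr h) opprD addrACA scalerBr.
  exists (M + N) => h k; rewrite !mulrDl (le_trans (nuB _ _))//.
  exact: lerD.
move=> e e0; have e2 : 0 < e / 2 by rewrite divr_gt0.
apply: filterS2 (FB _ e2) (GK _ e2) => y yF yG k /=.
by rewrite subr3ACA (le_trans (nuB _ _))// [e in leRHS]splitr !mulrDl lerD.
Qed.

Lemma C2_at_sub F G x dF dG d2F d2G :
  C2_at nu D F x dF d2F -> C2_at nu D G x dG d2G ->
  C2_at nu D (F \- G) x (fun y => dF y \- dG y) (fun y h => d2F y h \- d2G y h).
Proof.
move=> [f1 f2 cf] [g1 g2 cg]; split.
- by apply: filterS2 f1 g1 => y; exact: frechet_diff_at_sub.
- by apply: filterS2 f2 g2 => y; exact: frechet_diff2_at_sub.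
move=> e e0; have e2 : 0 < e / 2 by rewrite divr_gt0.
apply: filterS2 (cf _ e2) (cg _ e2) => y yF yG h k /=.
rewrite opprD addrACA -opprD (le_trans (nuB _ _))//.
by rewrite [e in leRHS]splitr !mulrDl lerD.
Qed.
End difference.

(** A bounded linear coordinate [l] is its own first order expansion, so that
adjoining it to [F] leaves the remainders unchanged. *)
Section pairing.
Context {R : realType} {U : normedModType R} {V : lmodType R}.
Variables (nu : V -> R) (D : set U) (l : U -> R).
Hypothesis linl : linear (l : U -> R^o).
Hypothesis shortl : forall u, `|l u| <= `|u|.

Let maxnu (y : R * V) : R := Num.max `|y.1| (nu y.2).

Let pair0D (a : R) (u v : V) :
  ((0 : R), a *: u + v) = a *: ((0 : R), u) + ((0 : R), v) :> R * V.
Proof. by apply: injective_projections; rewrite /= ?scaler0 ?addr0. Qed.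

Lemma frechet_diff_at_pair F x L : frechet_diff_at nu D F x L ->
  frechet_diff_at maxnu D (fun y => (l y, F y)) x (fun h => (l h, L h)).
Proof.
move=> [[linL [M LM]] FL]; split.
  split=> [a u v|]; first by rewrite linl linL.
  exists (`|M| + 1) => h; rewrite /maxnu/= ge_max mulrDl mul1r; apply/andP; split.
    by rewrite (le_trans (shortl _))// lerDr mulr_ge0.
  by rewrite (le_trans (LM _))// ler_wpDr// ler_wpM2r// ler_norm.
move=> e e0; apply: filterS (FL _ e0) => y yL; rewrite /maxnu/=.
by rewrite ge_max yL (bare_linearB linl) subrr normr0 mulr_ge0// ltW.
Qed.

Lemma frechet_diff2_at_pair dF x B : frechet_diff2_at nu D dF x B ->
  frechet_diff2_at maxnu D (fun y h => (l h, dF y h)) x (fun h k => (0, B h k)).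
Proof.
move=> [[Bl Br [M BM]] FB]; split.
  split=> [k a u v|h a u v|].
  - by rewrite (Bl k) pair0D.
  - by rewrite (Br h) pair0D.
  exists `|M| => h k; rewrite /maxnu/= normr0 ge_max !mulr_ge0//=.
  by rewrite (le_trans (BM _ _))// !ler_wpM2r// ler_norm.
move=> e e0; apply: filterS (FB _ e0) => y yB k; rewrite /maxnu/=.
by rewrite ge_max yB subrr subr0 normr0 !mulr_ge0// ltW.
Qed.

Lemma C2_at_pair F x dF d2F : C2_at nu D F x dF d2F ->
  C2_at maxnu D (fun y => (l y, F y)) x (fun y h => (l h, dF y h))
    (fun y h k => (0, d2F y h k)).
Proof.
move=> [d1 d2 cont]; split.
- by apply: filterS d1 => y; exact: frechet_diff_at_pair.
- by apply: filterS d2 => y; exact: frechet_diff2_at_pair.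
move=> e e0; apply: filterS (cont _ e0) => y yB h k; rewrite /maxnu/=.
by rewrite ge_max yB subr0 normr0 !mulr_ge0// ltW.
Qed.
End pairing.

Lemma is_derive1_littleo {R : realType} (g : R -> R) (x l : R) :
  (forall e, 0 < e -> exists2 r, 0 < r &
     forall y, `|y - x| < r -> `|g y - g x - l * (y - x)| <= e * `|y - x|) ->
  is_derive x 1 g l.
Proof.
move=> gl.
have gcvg : (h^-1 *: ((g \o shift x) (h *: 1) - g x) : R) @[h --> 0^'] --> l.
  apply/cvgrPdist_le => e /gl[r r0 rg].
  apply/near_within_normP; exists r => // h; rewrite subr0 => hr h0 /=.
  rewrite scaler1 /shift/= -normrN opprB.
  have -> : h^-1 * (g (h + x) - g x) - l = h^-1 * (g (h + x) - g x - l * h).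
    by rewrite [RHS]mulrBr [h^-1 * (l * h)]mulrCA mulVf// mulr1.
  have := rg (h + x); rewrite addrK => /(_ hr) hl.
  by rewrite normrM normfV ler_pdivrMl ?normr_gt0// [leRHS]mulrC.
apply: DeriveDef; first by apply/cvg_ex; exists l.
exact: cvg_lim gcvg.
Qed.

(** * Symmetry of second derivatives on a half-plane *)

Section mean_value.
Context {R : realType}.
Implicit Types (a b c : R).

Lemma frechet_continuous_within (I : set R) (g l : R -> R^o) c :
  frechet_diff_at (@Num.norm R R^o) I g c l -> g y @[y --> within I (nbhs c)] --> g c.
Proof.
move=> [[_ [M lM]] gl].
apply/cvgrPdist_le => e e0.
have M0 : 0 < `|M| + 1 by rewrite ltr_wpDl.
have /near_within_normP[r r0 rg] := gl _ ltr01.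
apply/near_within_normP; exists (Num.min r (e / (`|M| + 1))).
  by rewrite lt_min r0 divr_gt0.
move=> y; rewrite lt_min => /andP[yr ye] Iy /=.
have := rg _ yr Iy; rewrite mul1r => {}rg.
rewrite -normrN opprB -[g y - g c](subrK (l (y - c))) (le_trans (ler_normD _ _))//.
rewrite (le_trans (lerD rg (lM _)))//.
rewrite (@le_trans _ _ ((`|M| + 1) * `|y - c|))//.
  by rewrite mulrDl mul1r addrC lerD2r ler_wpM2r// ler_norm.
by rewrite mulrC -ler_pdivlMr// ltW.
Qed.

(** At an end point of the segment only one-sided differentiability is available;
it gives continuity there, which is all that the mean value theorem asks for. *)
Lemma frechet_MVT (g : R -> R^o) (l : R -> R -> R^o) a b : a < b ->
  (forall c, c \in `[a, b] -> frechet_diff_at (@Num.norm R R^o) `[a, b] g c (l c)) ->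
  exists2 c, c \in `[a, b] & g b - g a = l c (b - a).
Proof.
move=> ab gl.
have lZ c (r : R) : c \in `[a, b] -> l c r = l c 1 * r.
  move=> /gl[[linl _] _]; have := bare_linearZ linl r 1.
  by rewrite scaler1 => ->; rewrite mulrC.
have [c cab gE] : exists2 c, c \in `]a, b[ & g b - g a = l c 1 * (b - a).
  apply: (@MVT R g (fun c => l c 1)) => //.
  - move=> c cab; have cab' : c \in `[a, b] by apply: subset_itv_oo_cc.
    apply: is_derive1_littleo => e e0.
    have [_ /(_ _ e0) /near_within_normP[r r0 rg]] := gl _ cab'.
    move: (cab); rewrite in_itv/= => /andP[ac cb].
    exists (Num.min r (Num.min (c - a) (b - c))).
      by rewrite !lt_min r0 !subr_gt0 ac.
    move=> y; rewrite !lt_min => /and3P[yr ya yb].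
    rewrite -lZ//; apply: rg => //=.
    rewrite in_itv/=; move: ya yb; rewrite !ltr_norml; lra.
  - apply/subspace_continuousP => c cab; exact: frechet_continuous_within (gl _ cab).
have cab' : c \in `[a, b] by apply: subset_itv_oo_cc.
by exists c => //; rewrite gE -lZ.
Qed.
End mean_value.

Section schwarz.
Context {R : realType} (signed : bool).
Let D : set (R * R) := source signed.
Let normo : R^o -> R := @Num.norm R R^o.

Let normoB (u v : R^o) : normo (u - v) <= normo u + normo v.
Proof. exact: ler_normB. Qed.

Let sourceP (x : R * R) : 0 <= x.1 -> D x.
Proof. by rewrite /D /source; case: signed. Qed.

(** Both mean value arguments stay in the square with side [t] in the first
quadrant, which lies in the source whether or not the parameter is signed. *)
Lemma schwarz_scalar (F : R * R -> R^o) dF B :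
  (\forall x \near within D (nbhs (0, 0)), frechet_diff_at normo D F x (dF x)) ->
  frechet_diff2_at normo D dF (0, 0) B ->
  B (1, 0) (0, 1) = B (0, 1) (1, 0).
Proof.
move=> /near_within_normP[r1 r10 Fdiff] [[Bl Br _] dFB].
apply/eqP; rewrite -subr_eq0 -normr_eq0 eq_le normr_ge0 andbT.
apply/ler_addgt0Pr => e e0; rewrite add0r.
(* Four first order remainders enter the comparison; [e / 8] leaves room. *)
have e8 : 0 < e / 8 by rewrite divr_gt0.
have /near_within_normP[r2 r20 {}dFB] := dFB _ e8.
pose t := Num.min r1 r2 / 2.
have m0 : 0 < Num.min r1 r2 by rewrite lt_min r10.
have t0 : 0 < t by rewrite divr_gt0.
have /andP[tr1 tr2] : (t < r1) && (t < r2).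
  by rewrite -lt_min /t; move: m0; set m := Num.min _ _ => m0; lra.
have nrm (x1 x2 : R) : 0 <= x1 <= t -> 0 <= x2 <= t -> `|(x1, x2) - (0, 0)| <= t.
  move=> /andP[x10 x1t] /andP[x20 x2t]; rewrite prod_normE/= !subr0 ge_max.
  by rewrite !ger0_norm// x1t.
have diff (x1 x2 : R) : 0 <= x1 <= t -> 0 <= x2 <= t ->
    frechet_diff_at normo D F (x1, x2) (dF (x1, x2)).
  move=> x1t x2t; apply: Fdiff; first by rewrite (le_lt_trans (nrm _ _ _ _)).
  by apply: sourceP => /=; case/andP: x1t.
have incr (x1 x2 y1 y2 : R) k : 0 <= x1 <= t -> 0 <= x2 <= t ->
    0 <= y1 <= t -> 0 <= y2 <= t ->
    `|dF (x1, x2) k - dF (y1, y2) k - B ((x1, x2) - (y1, y2)) k| <=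
      e / 4 * t * `|k|.
  move=> x1t x2t y1t y2t.
  have near (z1 z2 : R) : 0 <= z1 <= t -> 0 <= z2 <= t ->
      `|dF (z1, z2) k - dF (0, 0) k - B ((z1, z2) - (0, 0)) k| <= e / 8 * t * `|k|.
    move=> z1t z2t; rewrite (le_trans (dFB _ _ _ _))//.
    - by rewrite (le_lt_trans (nrm _ _ _ _)).
    - by apply: sourceP => /=; case/andP: z1t.
    - by rewrite ler_wpM2r// ler_wpM2l ?nrm// ltW.
  have -> : dF (x1, x2) k - dF (y1, y2) k - B ((x1, x2) - (y1, y2)) k =
    (dF (x1, x2) k - dF (0, 0) k - B ((x1, x2) - (0, 0)) k) -
    (dF (y1, y2) k - dF (0, 0) k - B ((y1, y2) - (0, 0)) k).
    have Bk u v : B (u - v) k = B u k - B v k := bare_linearB (Bl k) u v.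
    rewrite !Bk; ring.
  rewrite (le_trans (ler_normB _ _))// (le_trans (lerD (near _ _ _ _) (near _ _ _ _)))//.
  by rewrite -!mulrDl; lra.
have BZ u v : B (t *: u) (t *: v) = t ^+ 2 * B u v.
  by rewrite (bare_linearZ (Bl _)) (bare_linearZ (Br _)) scalerA.
have t0t : 0 <= t <= t by rewrite lexx ltW.
have z0t : 0 <= (0 : R) <= t by rewrite lexx ltW.
(* The second difference of F over the square, first as the increment in the
   second variable of a horizontal difference, then the other way round. *)
have [c ct cE] : exists2 c, c \in `[0, t] &
    (F (t, t) - F (0, t)) - (F (t, 0) - F (0, 0)) =
    dF (t, c) (0, t) - dF (0, c) (0, t).
  pose g (s : R) : R^o := F (t, s) - F (0, s).
  pose l (s h : R) : R^o := dF (t, s) (0, h) - dF (0, s) (0, h).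
  have [c ct cE] : exists2 c, c \in `[0, t] & g t - g 0 = l c (t - 0).
    apply: frechet_MVT => // c ct.
    have vertical (x : R) : 0 <= x <= t ->
        frechet_diff_at normo `[0, t] (fun s => F (x, s)) c (fun h => dF (x, c) (0, h)).
      move=> xt.
      apply: (@frechet_diff_at_pre _ _ _ _ normo D `[0, t]%classic
        (fun s : R => (x, s)) (fun h : R => (0, h))).
      - by move=> a u v; apply: injective_projections; rewrite /= ?scaler0 ?addr0.
      - by move=> y z; apply: injective_projections; rewrite /= ?subrr.
      - by move=> u; rewrite prod_normE/= normr0 ge_max normr_ge0 lexx.
      - by move=> u _; apply: sourceP => /=; case/andP: xt.
      - by apply: diff => //; move: ct; rewrite in_itv.
    exact: frechet_diff_at_sub normoB _ _ _ _ _ (vertical _ t0t) (vertical _ z0t).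
  by exists c => //; rewrite subr0 in cE.
have [c' ct' cE'] : exists2 c, c \in `[0, t] &
    (F (t, t) - F (t, 0)) - (F (0, t) - F (0, 0)) =
    dF (c, t) (t, 0) - dF (c, 0) (t, 0).
  pose g (s : R) : R^o := F (s, t) - F (s, 0).
  pose l (s h : R) : R^o := dF (s, t) (h, 0) - dF (s, 0) (h, 0).
  have [c' ct' cE'] : exists2 c, c \in `[0, t] & g t - g 0 = l c (t - 0).
    apply: frechet_MVT => // x xt.
    have horizontal (y : R) : 0 <= y <= t ->
        frechet_diff_at normo `[0, t] (fun s => F (s, y)) x (fun h => dF (x, y) (h, 0)).
      move=> yt.
      apply: (@frechet_diff_at_pre _ _ _ _ normo D `[0, t]%classic
        (fun s : R => (s, y)) (fun h : R => (h, 0))).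
      - by move=> a u v; apply: injective_projections; rewrite /= ?scaler0 ?addr0.
      - by move=> u v; apply: injective_projections; rewrite /= ?subrr.
      - by move=> u; rewrite prod_normE/= normr0 ge_max normr_ge0 lexx.
      - by move=> u /=; rewrite in_itv/= => /andP[u0 _]; apply: sourceP.
      - by apply: diff => //; move: xt; rewrite in_itv.
    exact: frechet_diff_at_sub normoB _ _ _ _ _ (horizontal _ t0t) (horizontal _ z0t).
  by exists c' => //; rewrite subr0 in cE'.
rewrite in_itv/= in ct; rewrite in_itv/= in ct'.
have e1 : (t, 0) = t *: ((1 : R), (0 : R)) :> R * R.
  by apply: injective_projections; rewrite /= ?scaler0 ?scaler1 ?mulr1 ?mulr0.
have e2 : (0, t) = t *: ((0 : R), (1 : R)) :> R * R.
  by apply: injective_projections; rewrite /= ?scaler0 ?scaler1 ?mulr1 ?mulr0.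
have /= := incr _ _ _ _ (0, t) t0t ct z0t ct.
have /= := incr _ _ _ _ (t, 0) ct' t0t ct' z0t.
rewrite -cE -cE' !prod_normE/= !normr0 (ger0_norm (ltW t0)).
rewrite (_ : (t, c) - (0, c) = (t, 0)); last first.
  by apply: injective_projections; rewrite /= ?subr0 ?subrr.
rewrite (_ : (c', t) - (c', 0) = (0, t)); last first.
  by apply: injective_projections; rewrite /= ?subr0 ?subrr.
(* Both mean values approximate the same second difference, and the errors
   [e / 4 * t ^ 2] add up to less than [e * t ^ 2]. *)
rewrite e1 e2 !BZ (max_l (ltW t0)) (max_r (ltW t0)) => S1 S2.
have t2 : 0 < t ^+ 2 by rewrite exprn_gt0.
rewrite -(ler_pM2l t2) -{1}(ger0_norm (ltW t2)) -normrM mulrBr.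
move: S1 S2; rewrite !ler_norml; lra.
Qed.
End schwarz.

(** * The space L^2 and maps into it *)

Lemma quotmod_pi_linear {R : nzRingType} {V : lmodType R} (S : zmodClosed V)
  (SZ : scaler_closed S) : linear (quotmod_pi SZ).
Proof. by move=> a u v; rewrite quotmod_piD -quotmod_piZ. Qed.

Section l2dot.
Context {d : measure_display} {T : measurableType d} {R : realType}.
Context {mu : {measure set T -> \bar R}}.
Implicit Types (f g h : L2fun mu).

Lemma l2_integrableM f g : mu.-integrable setT (EFin \o (fun t => f t * g t)).
Proof. by apply/Lfun1_integrable; apply: Lfun2_mul_Lfun1; exact: LfunP. Qed.

Lemma l2dotC f g : l2dot f g = l2dot g f.
Proof. by apply: eq_Rintegral => t _; rewrite mulrC. Qed.

Lemma l2dot_linear h : linear (fun f => l2dot f h : R^o).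
Proof.
move=> a f g; rewrite /l2dot -[_ *: _ as X in _ = X + _]/(a * _).
rewrite -RintegralZl//; last exact: l2_integrableM.
rewrite -RintegralD//; last exact: l2_integrableM.
  apply: eq_Rintegral => t _.
  by rewrite mulrA -mulrDl.
by under eq_fun do rewrite mulrA; exact: (l2_integrableM (a *: f) h).
Qed.

Lemma l2norm_ge0 f : 0 <= l2norm f.
Proof. by rewrite fine_ge0// Lnorm_ge0. Qed.

Lemma l2dotff f : l2dot f f = l2norm f ^+ 2.
Proof.
apply: EFin_inj.
rewrite -powR_mulrn ?l2norm_ge0// -poweR_EFin finite_norm_fine powR_Lnorm//.
rewrite /l2dot /Rintegral fineK; last exact: integrable_fin_num (l2_integrableM f f).
apply: eq_integral => t _; rewrite abse_EFin poweR_EFin powR_mulrn//.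
by rewrite real_normK ?num_real// expr2.
Qed.

Lemma l2normB f g : l2norm (f - g) <= l2norm f + l2norm g.
Proof.
by rewrite (le_trans (l2normD _ _))// -scaleN1r l2normZ normrN1 mul1r.
Qed.

Lemma l2dot_CS f g : `|l2dot f g| <= l2norm f * l2norm g.
Proof.
rewrite /l2dot (le_trans (le_normr_Rintegral _ (l2_integrableM f g)))//.
rewrite -lee_fin EFinM !finite_norm_fine /Rintegral fineK; last first.
  apply: integrable_fin_num => //.
  exact: (integrable_abse (l2_integrableM f g)).
have := @hoelder _ _ _ mu f g 2 2; rewrite Lnorm1; apply => //.
by rewrite [RHS]splitr !div1r.
Qed.

Lemma ae_zero_l2norm f : f \in ae_zero (mu := mu) <-> l2norm f = 0.
Proof.
split=> [/asboolP f0|/fine_Lnormr_eq0 f0]; last first.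
  by apply/asboolP; apply: filterS f0 => t /(_ I).
apply/eqP; rewrite -sqrf_eq0 -l2dotff; apply/eqP.
rewrite /l2dot /Rintegral (@ae_eq_integral _ _ _ mu setT (cst 0%E))//.
- by rewrite integral0.
- by have /integrableP[] := l2_integrableM f f.
- by apply: filterS f0 => t /= -> _; rewrite mulr0.
Qed.
End l2dot.

Section L2norm.
Context {d : measure_display} {T : measurableType d} {R : realType}.
Context {mu : {measure set T -> \bar R}}.
Implicit Types (f g h : L2fun mu) (x y : L2 mu).

(** The infimum that defines the quotient norm is attained everywhere: adding a
null function does not change the norm. *)
Lemma L2normE f : L2norm (L2class f) = l2norm f.
Proof.
suff E : [set l2norm v | v in [set v | L2class v = L2class f]] = [set l2norm f].
  by rewrite /L2norm /quotnorm E inf1.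
apply/seteqP; split=> [_ [g /quotmod_piP gf <-]|_ ->]; last by exists f.
move/ae_zero_l2norm : (gf) => gf0.
apply/eqP; rewrite eq_le; apply/andP; split.
  by rewrite -[g](subrK f) (le_trans (l2normD _ _))// gf0 add0r.
by rewrite -{1}[f](subKr g) (le_trans (l2normB _ _))// gf0 addr0.
Qed.

(** Induction principle that replaces a class by a representative. *)
Lemma L2classP (P : L2 mu -> Prop) : (forall f, P (L2class f)) -> forall x, P x.
Proof. by move=> Pf x; rewrite -[x]quotmod_reprK; exact: Pf. Qed.

Lemma L2norm_ge0 x : 0 <= L2norm x.
Proof. by elim/L2classP : x => f; rewrite L2normE l2norm_ge0. Qed.

Lemma L2normB x y : L2norm (x - y) <= L2norm x + L2norm y.
Proof.
elim/L2classP : x => f; elim/L2classP : y => g.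
by rewrite -(bare_linearB (@quotmod_pi_linear _ _ _ _)) !L2normE l2normB.
Qed.

Lemma L2normZ a x : L2norm (a *: x) = `|a| * L2norm x.
Proof.
elim/L2classP : x => f.
by rewrite -(bare_linearZ (@quotmod_pi_linear _ _ _ _)) !L2normE l2normZ.
Qed.

Lemma L2norm_eq0 x : L2norm x = 0 -> x = 0.
Proof.
elim/L2classP : x => f; rewrite L2normE => /ae_zero_l2norm f0.
rewrite -(bare_linear0 (@quotmod_pi_linear _ _ _ _)).
by apply/quotmod_piP; rewrite subr0.
Qed.

Definition L2pair h x : R^o := l2dot (repr x) h.

Lemma L2pair_class h f : L2pair h (L2class f) = l2dot f h.
Proof.
rewrite /L2pair; set g := repr _.
have /ae_zero_l2norm gf : g - f \in ae_zero (mu := mu).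
  by apply/(quotmod_piP (ae_zero_submod mu)); exact: (quotmod_reprK (L2class f)).
apply/eqP; rewrite -subr_eq0 -(bare_linearB (l2dot_linear h)) -normr_le0.
by rewrite (le_trans (l2dot_CS _ _))// gf mul0r.
Qed.

Lemma L2pair_linear h : linear (L2pair h).
Proof.
move=> a x y; elim/L2classP : x => f; elim/L2classP : y => g.
by rewrite -quotmod_pi_linear !L2pair_class l2dot_linear.
Qed.

(** Cauchy-Schwarz; one is added to the norm so that the constant is positive, as
postcomposition requires. *)
Lemma L2pair_bound h x : `|L2pair h x| <= (l2norm h + 1) * L2norm x.
Proof.
elim/L2classP : x => f; rewrite L2pair_class L2normE.
by rewrite (le_trans (l2dot_CS _ _))// mulrC ler_wpM2r ?l2norm_ge0// lerDl.
Qed.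

(** Pair the difference with itself. *)
Lemma L2pair_separates x y : (forall h, L2pair h x = L2pair h y) -> x = y.
Proof.
move=> xy; apply/eqP; rewrite -subr_eq0; apply/eqP.
have {}xy h : L2pair h (x - y) = 0 by rewrite (bare_linearB (L2pair_linear h)) xy subrr.
elim/L2classP : (x - y) xy => f /(_ f).
rewrite L2pair_class l2dotff => /eqP; rewrite sqrf_eq0 => /eqP f0.
by apply: L2norm_eq0; rewrite L2normE.
Qed.

(** The mean value theorem fails for vector-valued maps; the pairings with
square-integrable functions reduce the claim to the real-valued case. *)
Lemma schwarz_L2 signed (F : R * R -> L2 mu) dF B :
  let D := source signed in
  (\forall x \near within D (nbhs (0, 0)), frechet_diff_at L2norm D F x (dF x)) ->
  frechet_diff2_at L2norm D dF (0, 0) B ->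
  B (1, 0) (0, 1) = B (0, 1) (1, 0).
Proof.
move=> D dFx dFB; apply: L2pair_separates => h.
have h0 : 0 < l2norm h + 1 by rewrite ltr_wpDl ?l2norm_ge0.
have lin := L2pair_linear h; have bnd := L2pair_bound h.
have := @schwarz_scalar _ signed (L2pair h \o F) (fun z => L2pair h \o dF z)
  (fun u => L2pair h \o B u).
apply.
  by apply: filterS dFx => x; exact: (frechet_diff_at_post lin h0 bnd).
exact: (frechet_diff2_at_post lin h0 bnd).
Qed.

(** The increments of [F] at [(0, t)] and [(0, -t)] agree while their linear parts
are opposite, so that [2 t L (0, 1)] is a difference of two remainders. *)
Lemma frechet_diff_even signed (F : R * R -> L2 mu) L :
  let D := source signed in
  frechet_diff_at L2norm D F (0, 0) L ->
  (\forall l \near (0 : R), F (0, l) = F (0, - l)) ->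
  L (0, 1) = 0.
Proof.
move=> D [[linL _] FL] /nbhs_normP[r1 /= r10 Feven].
apply: L2norm_eq0; apply/eqP; rewrite eq_le L2norm_ge0 andbT.
apply/ler_addgt0Pr => e e0; rewrite add0r.
have /near_within_normP[r2 r20 {}FL] := FL _ e0.
have m0 : 0 < Num.min r1 r2 by rewrite lt_min r10.
pose t := Num.min r1 r2 / 2.
have t0 : 0 < t by rewrite divr_gt0.
have /andP[tr1 tr2] : (t < r1) && (t < r2).
  by rewrite -lt_min /t; move: m0; set m := Num.min _ _ => m0; lra.
have bnd (s : R) : `|s| = t -> L2norm (F (0, s) - F (0, 0) - s *: L (0, 1)) <= e * t.
  move=> st; have nst : `|(0, s) - (0, 0) : R * R| = t.
    by rewrite prod_normE/= !subr0 normr0 st max_r// ltW.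
  have -> : s *: L (0, 1) = L ((0, s) - (0, 0)).
    rewrite -(bare_linearZ linL); congr L.
    by apply: injective_projections; rewrite /= subr0 ?scaler0// /GRing.scale/= mulr1.
  have := FL (0, s); rewrite nst; apply => //.
  by rewrite /D /source; case: (signed) => /=.
have F2 : t *: L (0, 1) *+ 2 =
  (F (0, - t) - F (0, 0) - (- t) *: L (0, 1)) - (F (0, t) - F (0, 0) - t *: L (0, 1)).
  have -> : F (0, t) = F (0, - t).
    by apply: Feven; rewrite /= sub0r normrN gtr0_norm.
  by rewrite [LHS]mulr2n scaleNr opprK opprB [X in _ = X + _]addrC addrACA subrr addr0.
have : L2norm (t *: L (0, 1) *+ 2) <= e * t + e * t.
  by rewrite F2 (le_trans (L2normB _ _))// lerD ?bnd// ?normrN gtr0_norm//.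
rewrite -scaler_nat !L2normZ normr_nat gtr0_norm//.
by move=> tN; rewrite -(ler_pM2l t0); move: tN; move: (L2norm _) => N; lra.
Qed.
End L2norm.

(** * Orthogonal projection onto finitely generated subspaces *)

Section projection.
Context {d : measure_display} {T : measurableType d} {R : realType}.
Context {mu : {measure set T -> \bar R}}.
Implicit Types (f g h : L2fun mu).

Lemma l2dotBl f g h : l2dot (f - g) h = l2dot f h - l2dot g h.
Proof. exact: bare_linearB (l2dot_linear h) f g. Qed.

Lemma l2dotDl f g h : l2dot (f + g) h = l2dot f h + l2dot g h.
Proof. exact: bare_linearD (l2dot_linear h) f g. Qed.

Lemma l2dotZl a f h : l2dot (a *: f) h = a * l2dot f h.
Proof. exact: bare_linearZ (l2dot_linear h) a f. Qed.

Lemma l2dot_eq0 f h : l2dot h h = 0 -> l2dot f h = 0.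
Proof.
rewrite l2dotff => /eqP; rewrite sqrf_eq0 => /eqP h0.
by apply/eqP; rewrite -normr_le0 (le_trans (l2dot_CS _ _))// h0 mulr0.
Qed.

(** Gram-Schmidt: with [r] the part of the new vector [v] orthogonal to the previous
ones, the projection is corrected by the multiple [a] of [r]. The last clause
says that the projection stays in the span of [l], in the dual form in which
the recursion uses it. *)
Lemma orth_seq (M : set (L2fun mu)) (l : seq (L2fun mu)) :
  M 0 -> (forall f g, M f -> M g -> M (f + g)) -> (forall a f, M f -> M (a *: f)) ->
  (forall v, v \in l -> M v) ->
  forall f, exists g, [/\ M g,
    forall v, v \in l -> l2dot (f - g) v = 0 &
    forall w, (forall v, v \in l -> l2dot w v = 0) -> l2dot w g = 0].
Proof.
move=> M0 MD MZ; elim: l => [_ f|v l IH Ml f].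
  by exists 0; split=> // w _; rewrite l2dotC; exact: bare_linear0 (l2dot_linear w).
have {}IH := IH (fun u ul => Ml u (@mem_behead _ (v :: l) u ul)).
have [g [Mg fg gorth]] := IH f; have [b [Mb vb borth]] := IH v.
pose r := v - b; pose a := l2dot (f - g) r / l2dot r r.
have Mr : M r by rewrite /r -scaleN1r; apply: MD; [exact/Ml/mem_head|exact: MZ].
have gr u : l2dot (f - (g + a *: r)) u = l2dot (f - g) u - a * l2dot r u.
  by rewrite opprD addrA (l2dotBl (f - g)) l2dotZl.
have forth u : u \in l -> l2dot (f - (g + a *: r)) u = 0.
  by move=> ul; rewrite gr fg// vb// mulr0 subrr.
exists (g + a *: r); split; first by apply: MD => //; exact: MZ.
- move=> u; rewrite inE => /predU1P[->|]; last exact: forth.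
  rewrite -[v](subrK b) -/r l2dotC l2dotDl ![l2dot _ (f - _)]l2dotC borth//.
  rewrite addr0 gr /a.
  (* If [r] is null then all its pairings vanish, [f - g] is already orthogonal
     to it, and the correction [a *: r] changes nothing. *)
  have [r0|r0] := eqVneq (l2dot r r) 0; last by rewrite mulfVK// subrr.
  by rewrite r0 mulr0 subr0 l2dot_eq0.
- move=> w worth; rewrite l2dotC l2dotDl l2dotZl ![l2dot _ w]l2dotC.
  have wl u : u \in l -> l2dot w u = 0 by move=> ul; rewrite worth// inE ul orbT.
  rewrite gorth// add0r l2dotC l2dotBl ![l2dot _ w]l2dotC borth// worth ?mem_head//.
  by rewrite subrr mulr0.
Qed.

Lemma closed_span_gen k (s : 'I_k -> L2fun mu) i : closed_span s (s i).
Proof.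
move=> e e0; exists (fun j => (j == i)%:R).
rewrite (bigD1 i)//= eqxx scale1r big1 ?addr0 ?subrr ?l2norm0// => j /negPf ->.
by rewrite scale0r.
Qed.

(** Orthogonality to the generators passes to the closure by Cauchy-Schwarz. *)
Lemma closed_span_orth k (s : 'I_k -> L2fun mu) w : (forall i, l2dot w (s i) = 0) ->
  forall n, closed_span s n -> l2dot w n = 0.
Proof.
move=> ws n sn; apply/eqP; rewrite -normr_le0; apply/ler_addgt0Pr => e e0.
have w0 : 0 < l2norm w + 1 by rewrite ltr_wpDl ?l2norm_ge0.
have [c nc] := sn _ (divr_gt0 e0 w0).
have -> : l2dot w n = l2dot w (n - \sum_(i < k) c i *: s i).
  rewrite ![l2dot w _]l2dotC l2dotBl; suff -> : l2dot (\sum_(i < k) c i *: s i) w = 0.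
    by rewrite subr0.
  elim/big_ind : _ => [|f g f0 g0|i _]; first exact: bare_linear0 (l2dot_linear w).
    by rewrite l2dotDl f0 g0 addr0.
  by rewrite l2dotZl l2dotC ws mulr0.
rewrite add0r (le_trans (l2dot_CS _ _))//.
rewrite (@le_trans _ _ ((l2norm w + 1) * (e / (l2norm w + 1))))//.
  by apply: ler_pM; rewrite ?l2norm_ge0// ?lerDl// ltW.
by rewrite mulrC mulfVK// gt_eqF.
Qed.

Lemma orth_projP k (s : 'I_k -> L2fun mu) f :
  closed_span s (orth_proj (closed_span s) f) /\
  forall n, closed_span s n -> l2dot (f - orth_proj (closed_span s) f) n = 0.
Proof.
have [s0 sD sZ] := closed_span_submod s.
have sl v : v \in [seq s i | i <- enum 'I_k] -> closed_span s v.
  by move=> /mapP[i _ ->]; exact: closed_span_gen.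
have [g [sg fg _]] := orth_seq s0 sD sZ sl f.
rewrite /orth_proj; case: xgetP => [_ _ []//|/(_ g) []].
split=> //; apply: closed_span_orth => i; apply: fg.
by apply: map_f; rewrite mem_enum.
Qed.
End projection.

(** * Measures given by a density *)

Section change_of_density.
Context {d : measure_display} {T : measurableType d} {R : realType}.
Variables (mu nu : {measure set T -> \bar R}) (p : T -> R).
Hypothesis mp : measurable_fun setT p.
Hypothesis p0 : forall t, 0 <= p t.
Hypothesis nuE : forall A, measurable A -> nu A = (\int[mu]_(t in A) (p t)%:E)%E.
Import HBNNSimple.
Local Open Scope ereal_scope.

(** A simple function is a combination of indicators of its level sets, and for an
indicator the identity is [nuE]. *)
Let integral_density_nnsfun (h : {nnsfun T >-> R}) :
  \int[mu]_t (h t * p t)%:E = \int[nu]_t (h t)%:E.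
Proof.
rewrite integralT_nnsfun sintegralE.
under eq_integral do rewrite fimfunE mulr_fsuml// -fsumEFin//.
rewrite ge0_integral_fsum//; last 2 first.
- move=> r; apply/measurable_EFinP; apply: measurable_funM => //.
  exact: measurable_funM.
- by move=> r t _; rewrite EFinM mule_ge0 ?lee_fin// -lee_fin EFinM nnfun_muleindic_ge0.
apply: eq_fsbigr => r; rewrite inE => -[t _ <-].
have mA : measurable (h @^-1` [set h t]) by [].
rewrite nuE// [in RHS]integral_mkcond epatch_indic.
rewrite -ge0_integralZl_EFin//; last 2 first.
- by move=> u _; rewrite mule_ge0// lee_fin.
- apply: emeasurable_funM; first exact/measurable_EFinP.
  by apply/measurable_EFinP.
by apply: eq_integral => u _; rewrite -!EFinM -mulrA [(\1_ _ _ * _)%R]mulrC.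
Qed.

(** Monotone approximation by simple functions on both sides. The measure
[mu] may fail to be sigma-finite, which puts this identity outside the scope of
the Radon-Nikodym theorem. *)
Lemma integral_density (f : T -> R) : measurable_fun setT f ->
  (forall t, (0 <= f t)%R) -> \int[mu]_t (f t * p t)%:E = \int[nu]_t (f t)%:E.
Proof.
move=> mf f0.
have mEf : measurable_fun setT (EFin \o f) by exact/measurable_EFinP.
pose h := nnsfun_approx measurableT mEf.
have hf t : (h n t)%:E @[n --> \oo] --> (f t)%:E.
  by apply: cvg_nnsfun_approx => // u _; rewrite /= lee_fin.
have hnd t : {homo (fun n => h n t) : m n / (m <= n)%N >-> (m <= n)%R}.
  by move=> m n mn; exact/lefP/nd_nnsfun_approx.
have cvg_nu : \int[nu]_t (h n t)%:E @[n --> \oo] --> \int[nu]_t (f t)%:E.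
  have -> : \int[nu]_t (f t)%:E = \int[nu]_t limn (fun n => (h n t)%:E).
    by apply: eq_integral => t _; apply/esym/cvg_lim.
  apply: cvg_monotone_convergence => //.
  - by move=> n; exact/measurable_EFinP.
  - by move=> n t _; rewrite lee_fin.
  - by move=> t _ m n mn; rewrite lee_fin hnd.
have cvg_mu : \int[mu]_t (h n t * p t)%:E @[n --> \oo] --> \int[mu]_t (f t * p t)%:E.
  have -> : \int[mu]_t (f t * p t)%:E = \int[mu]_t limn (fun n => (h n t * p t)%:E).
    apply: eq_integral => t _; apply/esym/cvg_lim => //.
    under eq_fun do rewrite EFinM.
    by rewrite EFinM; apply: cvgeZr.
  apply: cvg_monotone_convergence => //.
  - by move=> n; apply/measurable_EFinP; exact: measurable_funM.
  - by move=> n t _; rewrite lee_fin mulr_ge0.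
  - by move=> t _ m n mn; rewrite lee_fin ler_wpM2r// hnd.
have E : (fun n => \int[mu]_t (h n t * p t)%:E) = fun n => \int[nu]_t (h n t)%:E.
  by apply/funext => n; exact: integral_density_nnsfun.
by rewrite E in cvg_mu; exact: cvg_unique cvg_mu cvg_nu.
Qed.

Local Close Scope ereal_scope.

Lemma measurable_sqrt_fun : measurable_fun setT (fun t => Num.sqrt (p t)).
Proof.
apply: (@measurableT_comp _ _ _ _ _ _ (@Num.sqrt R)) => //.
by apply: continuous_measurable_fun; exact: sqrt_continuous.
Qed.

(** The product is square-integrable for [mu], its square integral being that of
[f] for [nu]; so the default value in the definition of the embedding does not
occur. *)
Lemma hellinger_embE (f : L2fun nu) :
  hellinger_emb (mu := mu) p f = (fun t => Num.sqrt (p t) * f t) :> (T -> R).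
Proof.
have mf : measurable_fun setT f by [].
suff fP : (fun t => Num.sqrt (p t) * f t) \in Lfun mu 2%:E.
  exact: (insubdK (0 : L2fun mu) fP).
apply/andP; split; rewrite inE/=.
  by apply: measurable_funM => //; exact: measurable_sqrt_fun.
rewrite /finite_norm unlock /Lnorm poweR_lty//.
have : (\int[nu]_t (f t ^+ 2)%:E < +oo)%E.
  have /integrableP[_] := l2_integrableM f f.
  apply: le_lt_trans; rewrite le_eqVlt; apply/orP; left; apply/eqP.
  by apply: eq_integral => t _; rewrite /= ger0_norm -expr2 ?sqr_ge0.
rewrite -integral_density; last 2 first.
- exact: measurable_funX.
- by move=> t; rewrite sqr_ge0.
apply: le_lt_trans; rewrite le_eqVlt; apply/orP; left; apply/eqP.
apply: eq_integral => t _ /=.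
by rewrite powR_mulrn// real_normK ?num_real// exprMn sqr_sqrtr// mulrC.
Qed.

Lemma density_ae_eq0 (P : set T) : measurable P ->
  {ae mu, forall t, P t -> p t = 0} -> nu P = 0.
Proof.
move=> mP P0; rewrite nuE// (ae_eq_integral (cst 0%E))//.
- by rewrite integral0.
- by apply: (measurable_funS measurableT) => //; exact/measurable_EFinP.
- by apply: filterS P0 => t /= + Pt => ->.
Qed.

(** Where [f] and [g] differ, [p] vanishes almost everywhere, and [nu] does not
charge such a set. *)
Lemma hellinger_inj (f g : L2fun nu) :
  {ae mu, forall t, Num.sqrt (p t) * f t = Num.sqrt (p t) * g t} ->
  l2norm (f - g) = 0.
Proof.
move=> fg; apply/ae_zero_l2norm/asboolP.
have mN : measurable [set t | (f - g) t != 0].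
  rewrite (_ : mkset _ = ~` ((f - g) @^-1` [set 0])).
    by apply: measurableC; rewrite -[X in measurable X]setTI; exact: measurable_funP.
  by apply/seteqP; split=> t /= /eqP.
exists [set t | (f - g) t != 0]; split => //; last by move=> t /= /eqP.
apply: density_ae_eq0 => //; apply: filterS fg => t /= + fgt.
move=> /eqP; rewrite -subr_eq0 -mulrBr mulf_eq0 (negPf fgt) orbF sqrtr_eq0.
by move=> pt; apply/eqP; rewrite eq_le pt p0.
Qed.
End change_of_density.

(** * The effective space and its plane of efficient jets *)

(** Cramer's rule for the Gram matrix, whose determinant is the hypothesis. *)
Lemma gram_free {d : measure_display} {T : measurableType d} {R : realType}
  {mu : {measure set T -> \bar R}} (f g : L2fun mu) (a b : R) :
  0 < l2norm f ^+ 2 * l2norm g ^+ 2 - l2dot f g ^+ 2 ->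
  l2dot (a *: f + b *: g) f = 0 -> l2dot (a *: f + b *: g) g = 0 -> a = 0 /\ b = 0.
Proof.
rewrite !l2dotDl !l2dotZl !l2dotff [l2dot g f]l2dotC.
move: (l2norm f ^+ 2) (l2norm g ^+ 2) (l2dot f g) => F G H Delta fE gE.
have D0 : F * G - H ^+ 2 != 0 by rewrite gt_eqF.
split; apply: (mulIf D0); rewrite mul0r.
- have -> : a * (F * G - H ^+ 2) = G * (a * F + b * H) - H * (a * H + b * G) by ring.
  by rewrite fE gE !mulr0 subr0.
- have -> : b * (F * G - H ^+ 2) = F * (a * H + b * G) - H * (a * F + b * H) by ring.
  by rewrite fE gE !mulr0 subr0.
Qed.

Section effective_space.
Context {d : measure_display} {T : measurableType d} {R : realType}.
Context {mu nu : {measure set T -> \bar R}}.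
Context (p0 : T -> R) (k : nat) (s : 'I_k -> L2fun nu).
Local Notation E := (eff_space mu p0 s).
Let cls : L2fun mu -> E := eff_class p0 s.

Lemma eff_class_linear : linear cls.
Proof. exact: quotmod_pi_linear. Qed.

(** The effective space is defined as a quotient of functions, whereas derivatives
live in L^2; this is the induced map from the one to the other. *)
Definition eff_of_L2 (x : L2 mu) : E := cls (repr x).

Lemma eff_of_L2class f : eff_of_L2 (L2class f) = cls f.
Proof.
apply/quotmod_piP; set g := repr _.
have /asboolP gf : g - f \in ae_zero (mu := mu).
  by apply/(quotmod_piP (ae_zero_submod mu)); exact: (quotmod_reprK (L2class f)).
apply/asboolP; exists 0; first by have [] := closed_span_submod s.
by apply: filterS gf => t ->; rewrite mulr0.
Qed.

Lemma eff_of_L2_linear : linear eff_of_L2.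
Proof.
move=> a x y; elim/(@L2classP _ _ _ mu) : x => f; elim/(@L2classP _ _ _ mu) : y => g.
by rewrite -quotmod_pi_linear !eff_of_L2class eff_class_linear.
Qed.

(** Coarser classes have more representatives, hence a smaller infimum. *)
Lemma eff_of_L2_short (x : L2 mu) :
  quotnorm (SZ := GRing.subsemimod_closedZ (nuisance_image_submod p0 s)) l2norm
    (eff_of_L2 x) <= 1 * L2norm x.
Proof.
rewrite mul1r; elim/(@L2classP _ _ _ mu) : x => f; rewrite eff_of_L2class L2normE.
by apply: ge_inf; [exists 0 => _ [g _ <-]; exact: l2norm_ge0|exists f].
Qed.

Hypothesis mp : measurable_fun setT p0.
Hypothesis p0_ge0 : forall t, 0 <= p0 t.
Hypothesis nuE : forall A, measurable A -> nu A = (\int[mu]_(t in A) (p0 t)%:E)%E.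
Let emb : L2fun nu -> L2fun mu := hellinger_emb p0.

Lemma hellinger_emb_linear : linear emb.
Proof.
move=> a f g; apply/LfuneqP => t; rewrite /emb hellinger_embE//.
rewrite -[RHS]/(a * hellinger_emb p0 f t + hellinger_emb p0 g t) !hellinger_embE//.
by rewrite mulrCA -mulrDr.
Qed.

Lemma eff_class_emb_span n : closed_span s n -> cls (emb n) = 0.
Proof.
move=> sn; rewrite -(bare_linear0 eff_class_linear); apply/quotmod_piP; rewrite subr0.
by apply/asboolP; exists n => //; apply/nearW => t; rewrite /emb hellinger_embE.
Qed.

Lemma eff_class_emb_eq0 f : cls (emb f) = 0 ->
  exists2 n, closed_span s n & l2norm (f - n) = 0.
Proof.
rewrite -(bare_linear0 eff_class_linear).
move=> /quotmod_piP; rewrite subr0 => /asboolP[n sn fn]; exists n => //.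
apply: (hellinger_inj mp p0_ge0 nuE); apply: filterS fn => t.
by rewrite /emb hellinger_embE.
Qed.

Let perp f := f - orth_proj (closed_span s) f.

(** The projection lies in the nuisance space, hence has class zero. *)
Lemma eff_class_perp f : cls (emb (perp f)) = cls (emb f).
Proof.
rewrite (bare_linearB hellinger_emb_linear) (bare_linearB eff_class_linear).
by rewrite (eff_class_emb_span (orth_projP s f).1) subr0.
Qed.

(** A combination of the efficient jets that has class zero is, up to a null
function, in the nuisance space, hence orthogonal to both of them. *)
Lemma eff_class_perp_free f g :
  0 < l2norm (perp f) ^+ 2 * l2norm (perp g) ^+ 2 - l2dot (perp f) (perp g) ^+ 2 ->
  forall a b, a *: cls (emb (perp f)) + b *: cls (emb (perp g)) = 0 -> a = 0 /\ b = 0.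
Proof.
have orth h n : closed_span s n -> l2dot (perp h) n = 0 := (orth_projP s h).2 n.
move=> Delta a b.
rewrite -!(bare_linearZ eff_class_linear) -(bare_linearD eff_class_linear).
rewrite -!(bare_linearZ hellinger_emb_linear) -(bare_linearD hellinger_emb_linear).
move=> /eff_class_emb_eq0[n sn]; set w := a *: perp f + b *: perp g => wn.
have w0 h : l2dot w (perp h) = 0.
  rewrite -[w](subrK n) l2dotDl [l2dot n _]l2dotC orth// addr0 l2dotC.
  by rewrite l2dot_eq0// l2dotff wn expr0n.
exact: gram_free Delta (w0 f) (w0 g).
Qed.
End effective_space.

Lemma plane_coordinates {R : realType} {E : lmodType R} (u v : E) :
  (forall a b : R, a *: u + b *: v = 0 -> a = 0 /\ b = 0) ->
  exists A : E -> R * R, forall a b, A (a *: u + b *: v) = (a, b).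
Proof.
move=> free; exists (fun w => xget (0, 0) [set c | w = c.1 *: u + c.2 *: v]) => a b.
case: xgetP => [[a' b'] _ /= E1|/(_ (a, b)) []//].
have [] := free (a - a') (b - b').
  by rewrite !scalerBl addrACA -opprD E1 subrr.
by move=> /subr0_eq -> /subr0_eq ->.
Qed.

(** The pure [e ^ 2] term cancels, which is the effect of subtracting the values on
the first axis. *)
Lemma bilinear_diag {R : realType} {V : lmodType R} (B : R * R -> R * R -> V) :
  (forall k, linear (B^~ k)) -> (forall h, linear (B h)) ->
  B (0, 1) (1, 0) = B (1, 0) (0, 1) ->
  forall e l, B (e, l) (e, l) - B (e, 0) (e, 0) =
    (e * l *+ 2) *: B (1, 0) (0, 1) + l ^+ 2 *: B (0, 1) (0, 1).
Proof.
move=> Bl Br sym e l.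
have dec : (e, l) = e *: (1, 0) + l *: (0, 1) :> R * R.
  by apply: injective_projections; rewrite /= ?scaler0 ?addr0 ?add0r /GRing.scale/= mulr1.
have dec1 : (e, 0) = e *: (1, 0) :> R * R.
  apply: injective_projections => /=;
    by rewrite ?scaler0 ?addr0 ?add0r /GRing.scale/= ?mulr1.
rewrite dec dec1.
have BlD x y z : B (x + y) z = B x z + B y z := bare_linearD (Bl z) x y.
have BlZ a x z : B (a *: x) z = a *: B x z := bare_linearZ (Bl z) a x.
rewrite !(BlD, BlZ, bare_linearD (Br _), bare_linearZ (Br _)) !scalerA sym.
rewrite !scalerDr !scalerA addrAC [X in X - _ + _]addrC addrK addrA -scalerDl.
by rewrite [l * e]mulrC -mulr2n expr2.
Qed.

Lemma half_lincomb {R : realType} {V : lmodType R} (a b : R) (u v : V) :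
  2^-1 *: ((a *+ 2) *: u + b *: v) = a *: u + (b / 2) *: v.
Proof.
rewrite scalerDr !scalerA; congr (_ *: _ + _ *: _); last by rewrite mulrC.
by rewrite -[a *+ 2]mulr_natl mulKf.
Qed.

Lemma scale_lincomb {R : realType} {V : lmodType R} (a b c b' c' : R) (u v : V) :
  a *: (b *: u + c *: v) + (b' *: u + c' *: v) = (a * b + b') *: u + (a * c + c') *: v.
Proof. by rewrite scalerDr addrACA !scalerA -!scalerDl. Qed.

(** * The essential second jet *)

Theorem proposition4p2 (R : realType) (d : measure_display) (T : measurableType d)
  (varpi : {measure set T -> \bar R})
  (signed : bool)
  (p : R * R -> T -> R)
  (supp : set T)
  (P0 : probability T R)
  (k : nat) (q : 'rV[R]_k -> T -> R) (s : 'I_k -> L2fun P0)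
  (dPhi : R * R -> R * R -> L2 varpi)
  (d2Phi : R * R -> R * R -> R * R -> L2 varpi)
  (Jm Jp : L2fun P0) :
  let D := source signed in
  let p0 := p (0, 0) in
  let Phi := fun x : R * R => L2class (root_density varpi (p x)) in
  (\forall x \near within D (nbhs (0, 0)), is_density varpi (p x)) ->
  C2_at L2norm D Phi (0, 0) dPhi d2Phi ->
  (\forall l \near (0 : R), Phi (0, l) = Phi (0, - l)) ->
  measurable supp ->
  (\forall x \near within D (nbhs (0, 0)),
     {ae varpi, forall t, ~ supp t -> p x t = 0}) ->
  {ae varpi, forall t, supp t -> 0 < p0 t} ->
  (forall A, measurable A -> P0 A = \int[varpi]_(t in A) (p0 t)%:E)%E ->
  nuisance_scores varpi p0 q s ->
  centered Jm ->
  centered Jp ->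
  d2Phi (0, 0) (1, 0) (0, 1) = L2class (hellinger_emb p0 Jm) ->
  d2Phi (0, 0) (0, 1) (0, 1) = L2class (hellinger_emb p0 Jp) ->
  let N := closed_span s in
  let Jm_perp := Jm - orth_proj N Jm in
  let Jp_perp := Jp - orth_proj N Jp in
  0 < l2norm Jm_perp ^+ 2 * l2norm Jp_perp ^+ 2 - l2dot Jm_perp Jp_perp ^+ 2 ->
  let E := eff_space varpi p0 s in
  let plane : set E := eff_plane p0 s Jm_perp Jp_perp in
  exists (jet : R * R -> R * E) (A : E -> R * R),
    [/\ is_jet2 (eff_norm p0 s) D (eff_hellinger p0 s p) (0, 0) jet,
        forall x, plane (jet x).2,
        forall (a : R) (u v : E), plane u -> plane v ->
          A (a *: u + v) = a *: A u + A v,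
        set_bij plane setT A &
        let jetA := fun x => ((jet x).1, A (jet x).2) in
        (forall e l : R, jetA (e, l) = (e, (e * l, l ^+ 2 / 2))) /\
        (exists a b c1 c2 c3 : R,
           [/\ 0 < a, 0 < b, 0 < c1, 0 < c2 & 0 < c3] /\
           forall x, D x -> rescale3 c1 c2 c3 (jetA (rescale2 a b x)) = crosscap x)].
Proof.
move=> D p0 Phi dens C2Phi Peven _ _ _ P0E _ _ _ Jm2 Jp2 N Jm_perp Jp_perp Delta E plane.
have D0 : D (0, 0) by rewrite /D /source; case: (signed) => /=.
have at0 (Q : set (R * R)) : (\forall x \near within D (nbhs (0, 0)), Q x) -> Q (0, 0).
  by move=> /near_within_normP[r r0]; apply => //; rewrite subrr normr0.
have [mp p0_ge0 _] := at0 _ dens.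
have [dPhi1 dPhi2 _] := C2Phi.
have [[B1 B2 _] _] := at0 _ dPhi2.
have [[L0 _] _] := at0 _ dPhi1.
have sym : d2Phi (0, 0) (0, 1) (1, 0) = d2Phi (0, 0) (1, 0) (0, 1).
  by rewrite (schwarz_L2 dPhi1 (at0 _ dPhi2)).
have even0 := frechet_diff_even (at0 _ dPhi1) Peven.
pose u : E := eff_class p0 s (hellinger_emb p0 Jm_perp).
pose v : E := eff_class p0 s (hellinger_emb p0 Jp_perp).
have uE : eff_of_L2 p0 s (d2Phi (0, 0) (1, 0) (0, 1)) = u.
  by rewrite Jm2 eff_of_L2class /u eff_class_perp.
have vE : eff_of_L2 p0 s (d2Phi (0, 0) (0, 1) (0, 1)) = v.
  by rewrite Jp2 eff_of_L2class /v eff_class_perp.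
have [A AE] := plane_coordinates (eff_class_perp_free mp p0_ge0 P0E Delta).
have planeP a b : plane (a *: u + b *: v) by exists a, b.
exists (fun x => (x.1, (x.1 * x.2) *: u + (x.2 ^+ 2 / 2) *: v)), A; split.
- (* [axis] is the source projection whose composite with [Phi] is subtracted. *)
  pose axis (x : R * R) : R * R := (x.1, 0).
  have linP : linear axis.
    by move=> a x y; apply: injective_projections; rewrite /= ?scaler0 ?addr0.
  have shortP x : `|axis x| <= `|x|.
    by rewrite !prod_normE/= normr0 ge_max le_max lexx le_max normr_ge0.
  have PD x : D x -> D (axis x) by rewrite /D /source; case: (signed).
  have C2diff := C2_at_sub L2normB C2Phi
    (C2_at_pre linP (fun x y => esym (bare_linearB linP y x)) shortP PD C2Phi).
  have C2eff := C2_at_post (eff_of_L2_linear p0 s) ltr01 (eff_of_L2_short p0 s) C2diff.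
  have linl : linear ((fun x => x.1) : R * R -> R^o) by [].
  have shortl (x : R * R) : `|x.1| <= `|x| by rewrite prod_normE le_max lexx.
  have C2pair := C2_at_pair linl shortl C2eff.
  have FE : eff_hellinger p0 s p = fun x => (x.1, eff_of_L2 p0 s (Phi x - Phi (axis x))).
    apply/funext => x; rewrite /eff_hellinger; congr pair.
    by rewrite -(bare_linearB (@quotmod_pi_linear _ _ _ _)) eff_of_L2class.
  rewrite FE.
  eexists; eexists; split; first exact: C2pair.
  case=> e l; apply: injective_projections; rewrite /=.
    by rewrite scaler0 addr0 add0r.
  have lin := eff_of_L2_linear (mu := varpi) p0 s.
  (* The first order term is the derivative along the even axis. *)
  have -> : dPhi (0, 0) (e, l) - dPhi (0, 0) (axis (e, l)) = 0.
    rewrite -(bare_linearB L0) (_ : _ - _ = l *: (0, 1)).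
      by rewrite (bare_linearZ L0) even0 scaler0.
    apply: injective_projections => /=;
      by rewrite ?subrr ?subr0 ?scaler0 ?/GRing.scale/= ?mulr1.
  (* The factor [1 / 2] of the Taylor formula cancels against the two equal mixed
     terms, and remains in front of the even one. *)
  rewrite subrr (bare_linear0 lin) addr0 add0r bilinear_diag//.
  by rewrite lin (bare_linearZ lin) uE vE half_lincomb.
- by move=> x; exact: planeP.
- move=> a _ _ [b [c ->]] [b' [c' ->]].
  by rewrite scale_lincomb !AE; apply: injective_projections.
- split=> //.
  + move=> _ _ /set_mem[a [b ->]] /set_mem[a' [b' ->]].
    by rewrite !AE => -[-> ->].
  + by move=> [a b] _; exists (a *: u + b *: v) => //; exact: AE.
- split=> [e l|]; first by rewrite /= AE.
  (* Only the last coordinate differs from the cross-cap, by the factor [1 / 2]. *)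
  exists 1, 1, 1, 1, 2; split => // -[e l] _.
  by rewrite /rescale3 /rescale2 /crosscap/= AE !mul1r mulrCA mulfV ?mulr1.
Qed.
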